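(* Let $\Gamma$ be an infinite Abelian group which is not a torsion group, and let $T$ be a tree of diameter $5$ whose two central vertices $v_{c_1}$ and $v_{c_2}$ are both not support vertices. Then $T$ is $\Gamma$-vertex magic if and only if $\deg(v_{c_1})\neq 2$ and $\deg(v_{c_2})\neq 2$.
   Context: Graphs are finite, simple and undirected. For an additive Abelian group $\Gamma$ with identity $0$ and a graph $G$, a $\Gamma$-vertex magic labeling is a map $\ell:V(G)\to\Gamma\setminus\{0\}$ for which there is $\mu\in\Gamma$ with $w(v)=\sum_{u\in N(v)}\ell(u)=\mu$ for every vertex $v$; $G$ is $\Gamma$-vertex magic if it has such a labeling. A pendant vertex has degree $1$; a support vertex is a vertex adjacent to a pendant vertex. A tree of diameter $5$ has two (adjacent) central vertices $v_{c_1},v_{c_2}$, the two middle vertices of any longest path. A torsion group is one all of whose elements have finite order. *)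

(* Defs.v *)
From HB Require Import structures.
From mathcomp Require Import all_boot all_algebra.
From mathcomp Require Import boolp classical_sets cardinality.

Set Implicit Arguments.
Unset Strict Implicit.
Unset Printing Implicit Defensive.

Import GRing.Theory.

Record sgraph := SGraph {
  vertex :> finType;
  edge : rel vertex;
  edge_sym : symmetric edge;
  edge_irrefl : irreflexive edge
}.

Section Graph.
Variable G : sgraph.
Implicit Types (x y v : G) (s : seq G).

Definition degree v : nat := #|[pred u | edge v u]|.

Definition pendant_vertex v : bool := degree v == 1%N.

Definition support_vertex v : bool := [exists u, edge v u && pendant_vertex u].

Definition connected : Prop := forall x y, connect (@edge G) x y.

(* [ucycle] also accepts the empty sequence and an edge traversed back and
   forth; genuine graph cycles are those with at least three vertices. *)
Definition acyclic : Prop := forall s, ucycle (@edge G) s -> (size s <= 2)%N.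

Definition is_tree : Prop := [/\ (0 < #|G|)%N, connected & acyclic].

Definition walk_of_length x y (n : nat) : bool :=
  [exists p : n.-tuple G, path (@edge G) x p && (last x p == y)].

(* A shortest walk has fewer than #|G| edges, so the search is exhaustive;
   the value is #|G| when y is not reachable from x. *)
Definition dist x y : nat := find (walk_of_length x y) (iota 0 #|G|).

Definition diameter : nat := \max_(x : G) \max_(y : G) dist x y.

(* Paths are given by their sequences of vertices. *)
Definition simple_path s : bool := sorted (@edge G) s && uniq s.

Definition longest_path s : Prop :=
  simple_path s /\ forall t : seq G, simple_path t -> (size t <= size s)%N.

(* c1 and c2 are, in this order, the two middle vertices of some longest path.
   In a tree of odd diameter all longest paths have the same two middle
   vertices, and reversing a path exchanges their order. *)
Definition central_pair (c1 c2 : G) : Prop :=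
  exists s1 s2 : seq G,
    size s1 = size s2 /\ longest_path (s1 ++ [:: c1; c2] ++ s2).

Local Open Scope ring_scope.

Definition weight (Gamma : zmodType) (l : G -> Gamma) v : Gamma :=
  \sum_(u : G | edge v u) l u.

Definition vertex_magic_labeling (Gamma : zmodType) (l : G -> Gamma) : Prop :=
  (forall v, l v != 0) /\ exists mu : Gamma, forall v, weight l v = mu.

Definition vertex_magic (Gamma : zmodType) : Prop :=
  exists l : G -> Gamma, vertex_magic_labeling l.

End Graph.

Definition torsion_group (Gamma : zmodType) : Prop :=
  forall x : Gamma, exists2 n : nat, (0 < n)%N & (x *+ n = 0)%R.

(* Main.v *)
(** On such a tree every neighbour of a centre other than the opposite centre
    (an arm) is a support vertex whose remaining neighbours are all pendant.
    Pendant vertices force every arm to carry the magic constant mu, so the weight of c1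
    forces l(c2) = (2 - deg c1) mu, and symmetrically for c1; hence neither
    degree is 2.  Conversely, take mu of infinite order, label arms and centres
    in this way, and around each arm label all pendant vertices by -mu except
    one, which receives the (positive) multiple of mu that makes the weight of
    the arm equal to mu. *)

Require Import Defs.
From HB Require Import structures.
From mathcomp Require Import all_boot all_algebra.
From mathcomp Require Import boolp classical_sets cardinality.

Set Implicit Arguments.
Unset Strict Implicit.
Unset Printing Implicit Defensive.

Import GRing.Theory.

(** * Walks without backtracking, and distances in acyclic graphs *)

Section Walks.
Variable G : sgraph.
Implicit Types (x y : G) (p q s : seq G).

(** Forbidding only immediate backtracking is a local condition, easy to check where walks are
    glued; acyclicity turns it into simplicity. *)
Fixpoint reduced_walk s : bool :=
  if s is x :: s' then
    [&& (if s' is y :: s'' then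
           edge x y && (if s'' is z :: _ then x != z else true)
         else true)
      & reduced_walk s']
  else true.

Lemma reduced_walk_sorted s : reduced_walk s -> sorted (@edge G) s.
Proof.
elim: s => [//|x [|y s] IHs] //= /andP[/andP[exy _] rs].
by rewrite exy; apply: IHs.
Qed.

Lemma simple_path_reduced s : simple_path s -> reduced_walk s.
Proof.
rewrite /simple_path; elim: s => [//|x [|y s] IHs] // /andP[/= /andP[exy ps]].
case/andP=> xs us; rewrite exy /=; apply/andP; split; last first.
  by apply: IHs; rewrite /= ps us.
by case: s xs {ps us IHs} => // z s; rewrite !inE !negb_or => /and3P[].
Qed.

Hypothesis G_acyclic : acyclic G.

Lemma reduced_walk_uniq s : reduced_walk s -> uniq s.
Proof.
elim: s => [//|x s IHs] rxs; have /= /andP[_ rs] := rxs.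
have us := IHs rs; rewrite /= us andbT; apply/negP=> xs.
case/splitPr: xs rxs us => p1 p2 {IHs rs} rxs us.
have pxs := reduced_walk_sorted rxs.
(* The segment from [x] up to its recurrence is a closed walk with distinct vertices, so by
   acyclicity it has one or two: a loop, or a backtrack. *)
have cyc : ucycle (@edge G) (x :: p1).
  apply/andP; split.
    by move: pxs; rewrite /= -cat_rcons cat_path => /andP[].
  move: us; rewrite cat_uniq /= => /and3P[-> /norP[xp1 _] _].
  by rewrite andbT.
have := G_acyclic cyc; case: p1 {cyc us} rxs pxs => [|a [|b p1]] //=.
  by rewrite edge_irrefl.
by rewrite eqxx andbF.
Qed.

Lemma reduced_walk_catrev x p q :
    reduced_walk (x :: p) -> reduced_walk (x :: q) ->
    (forall z, ohead p = Some z -> ohead q <> Some z) ->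
  reduced_walk (catrev p (x :: q)).
Proof.
elim: p x q => [//|a p IHp] x q /=.
case/andP=> /andP[exa hx] rap rxq hpq; apply: IHp => //.
- rewrite [reduced_walk _]/= edge_sym exa rxq andbT /=.
  case: q {rxq} hpq => // b q /(_ a erefl) /= ab.
  by apply/eqP => eab; apply: ab; rewrite eab.
- move=> z; case: p hx {rap} => //= b p xb [<-] [exb].
  by rewrite exb eqxx in xb.
Qed.

(** Uniqueness of paths in a forest. Where the two walks first part, reversing one and appending the
    other gives a reduced walk, yet it meets the common endpoint twice. *)
Lemma reduced_walk_inj x p q :
    reduced_walk (x :: p) -> reduced_walk (x :: q) -> last x p = last x q ->
  p = q.
Proof.
elim: p x q => [|a p IHp] x [|b q] // rp rq.
- move=> /= lq; have := reduced_walk_uniq rq.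
  by rewrite cons_uniq lq mem_last.
- move=> /= lq; have := reduced_walk_uniq rp.
  by rewrite cons_uniq -lq mem_last.
have [eab|nab] := eqVneq a b => [|lpq].
  move: rp rq; rewrite -eab => /andP[_ rp] /andP[_ rq] /= lpq.
  by rewrite (IHp a q).
have /reduced_walk_uniq : reduced_walk (catrev (a :: p) (x :: b :: q)).
  apply: reduced_walk_catrev => // z [<-] [eba].
  by rewrite eba eqxx in nab.
rewrite catrevE cat_uniq => /and3P[_ /hasPn/(_ (last b q))] + _.
rewrite in_cons mem_last orbT mem_rev => /(_ isT) /negP[].
by rewrite -[last b q]/(last x (b :: q)) -lpq /= mem_last.
Qed.

Lemma dist_simple_path x p :
  simple_path (x :: p) -> dist x (last x p) = size p.
Proof.
move=> sp; have /andP[/= pxp uxp] := sp.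
have ltn : size p < #|G|.
  by have := max_card (mem (x :: p)); rewrite (card_uniqP _).
have wp : walk_of_length x (last x p) (size p).
  by apply/existsP; exists (in_tuple p); rewrite /= pxp eqxx.
have wmin n : walk_of_length x (last x p) n -> size p <= n.
  case/existsP=> [[q /= /eqP <-]] /andP[pq] /eqP lq.
  (* Any walk shortens to a simple path using some of its vertices, and that path must be [p]. *)
  case/shortenP: pq lq => q' pq' uq' sq' lq.
  have -> : p = q'.
    apply: (@reduced_walk_inj x) => //; first exact: simple_path_reduced.
    by apply: simple_path_reduced; rewrite /simple_path /= pq'.
  apply: uniq_leq_size => //; by case/andP: uq'.
(* Entry [i] of the searched list is [i], so the index that [find] returns is itself the length of a
   shortest walk. *)
apply/eqP; rewrite /dist eqn_leq; apply/andP; split.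
  rewrite leqNgt; apply/negP=> /(before_find 0).
  by rewrite nth_iota // add0n wp.
have hw : has (walk_of_length x (last x p)) (iota 0 #|G|).
  by apply/hasP; exists (size p); rewrite ?mem_iota.
apply: wmin; have := nth_find 0 hw.
by rewrite nth_iota ?add0n // -[X in _ < X](size_iota 0) -has_find.
Qed.

Lemma simple_path_diameter x p :
  simple_path (x :: p) -> size p <= diameter G.
Proof.
move=> sp; rewrite -(dist_simple_path sp).
exact: leq_trans (leq_bigmax (last x p)) (leq_bigmax x).
Qed.

Lemma diameter_simple_path :
    0 < #|G| -> connected G ->
  exists x, exists2 p, simple_path (x :: p) & size p = diameter G.
Proof.
move=> G0 Gc; rewrite /diameter.
have [x ->] := eq_bigmax (fun x : G => \max_(y : G) dist x y) G0.
have [y ->] := eq_bigmax (fun y : G => dist x y) G0.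
have /connectP[p pxp ->] := Gc x y; case/shortenP: pxp => p' pp' up' _.
have sp : simple_path (x :: p') by rewrite /simple_path /= pp'.
by exists x, p' => //; rewrite dist_simple_path.
Qed.

End Walks.

(** * Pendant vertices and degrees *)

Section Degree.
Variable G : sgraph.
Implicit Types u v w : G.

Lemma pendant_unique v u w :
  pendant_vertex v -> edge v u -> edge v w -> u = w.
Proof.
move=> /eqP dv vu vw; have /card_le1_eqP : degree v <= 1 by rewrite dv.
exact.
Qed.

Lemma pendantI v u : edge v u -> (forall w, edge v w -> w = u) ->
  pendant_vertex v.
Proof.
move=> vu uv; apply/eqP; rewrite -(card1 u); apply: eq_card => w; rewrite !inE.
by apply/idP/eqP => [/uv|->].
Qed.

Lemma npendant_other v u : edge v u -> ~~ pendant_vertex v ->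
  exists2 w, edge v w & w != u.
Proof.
move=> vu /negP nv; apply: contrapT => H; apply: nv; apply: (pendantI vu) => w vw.
by apply/eqP/negPn/negP => nwu; apply: H; exists w.
Qed.

Lemma degreeD1 v u : edge v u ->
  degree v = #|[pred w | edge v w && (w != u)]|.+1.
Proof.
move=> vu; rewrite /degree (cardD1 u) inE vu add1n; congr _.+1.
by apply: eq_card => w; rewrite !inE andbC.
Qed.

End Degree.

Local Open Scope ring_scope.

(** * Weights of vertices whose neighbours are labelled alike, up to one or two exceptions *)

Section Weight.
Variables (G : sgraph) (Gamma : zmodType) (l : G -> Gamma).
Implicit Types u v w : G.

Lemma weight_pendant v u : pendant_vertex v -> edge v u -> weight l v = l u.
Proof.
move=> pv vu; rewrite /weight (big_pred1 u) // => w /=.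
by apply/idP/eqP => [vw|->//]; apply: (pendant_unique pv).
Qed.

Lemma weight_const v u a : edge v u ->
    (forall w, edge v w -> w != u -> l w = a) ->
  weight l v = l u + a *+ (degree v).-1.
Proof.
move=> vu la; rewrite /weight (bigD1 u) //= (degreeD1 vu) /=; congr (_ + _).
by rewrite -sumr_const; apply: eq_bigr => w /andP[]; apply: la.
Qed.

Lemma weight_const2 v u u' a : edge v u -> edge v u' -> u' != u ->
    (forall w, edge v w -> w != u -> w != u' -> l w = a) ->
  weight l v = l u + l u' + a *+ (degree v - 2).
Proof.
move=> vu vu' nu la; rewrite /weight (bigD1 u) //= (bigD1 u') /=; last exact/andP.
rewrite addrA; congr (_ + _).
have -> : (degree v - 2)%N =
    #|[pred w | edge v w && (w != u) && (w != u')]|.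
  rewrite (degreeD1 vu) (cardD1 u') inE vu' nu /= subSS subSS subn0.
  by apply: eq_card => w; rewrite !inE andbC.
by rewrite -sumr_const; apply: eq_bigr => w /andP[/andP[? ?]]; apply: la.
Qed.

End Weight.

(** * Structure of a tree of diameter 5 around its centres *)

Section Diameter5.
Variable T : sgraph.
Hypotheses (T_tree : is_tree T) (T_diameter : diameter T = 5%N).
Implicit Types c u v w : T.

Let T_acyclic : acyclic T. Proof. by case: T_tree. Qed.

Lemma central_pair_sym c c' : central_pair c c' -> central_pair c' c.
Proof.
case=> s1 [s2 [ss [sp lp]]]; exists (rev s2), (rev s1); split.
  by rewrite !size_rev.
have -> : rev s2 ++ [:: c'; c] ++ rev s1 = rev (s1 ++ [:: c; c'] ++ s2).
  by rewrite !rev_cat -catA.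
split; last by move=> t /lp; rewrite size_rev.
rewrite /simple_path rev_uniq rev_sorted; move: sp => /andP[+ ->].
by rewrite andbT; apply: sub_sorted => x y /=; rewrite edge_sym.
Qed.

Lemma reduced_walk_size (s : seq T) : reduced_walk s -> (size s <= 6)%N.
Proof.
move=> rs; case: s rs => // x p rs; rewrite /= ltnS -T_diameter.
apply: (simple_path_diameter T_acyclic (x := x)).
by rewrite /simple_path (reduced_walk_sorted rs) (reduced_walk_uniq _ rs).
Qed.

(** This is the half of a longest path lying beyond [c]; walks arriving at [c] from an arm are
    prolonged by it to contradict the diameter. *)
Lemma central_pair_ray c c' : central_pair c c' ->
  exists b b', reduced_walk [:: c; c'; b; b'].
Proof.
case=> s1 [s2 [ss [sp lp]]].
have [T0 Tc _] := T_tree.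
have [x [p pp sizep]] := diameter_simple_path T_acyclic T0 Tc.
have rw := simple_path_reduced sp.
have := lp _ pp; rewrite /= sizep T_diameter size_cat /= ss => l6.
have := reduced_walk_size rw; rewrite size_cat /= ss => u6.
(* The longest path has exactly six vertices: at least six since some path realizes the diameter, at
   most six by [reduced_walk_size]. *)
have s2E : size s2 = 2.
  move: l6 u6; rewrite !addnS !ltnS addnn => l6 u6.
  by case: (size s2) l6 u6 => [|[|[|n]]] //; rewrite !doubleS.
case: s2 s2E {lp u6 l6 ss sp} rw => [|b [|b' [|]]] // _ rw; exists b, b'.
by elim: s1 rw => // a s1 IH /= /andP[_] /IH.
Qed.

Lemma central_pair_edge c c' : central_pair c c' -> edge c c'.
Proof. by case/central_pair_ray => b [b' /= /and4P[/andP[]]]. Qed.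

Definition arm c c' u : bool := edge c u && (u != c').

Lemma central_pair_arm c c' : central_pair c c' -> exists u, arm c c' u.
Proof.
case/central_pair_sym/central_pair_ray => u [v /=].
case/and4P=> /andP[_ nu] /andP[cu _] _ _.
by exists u; rewrite /arm cu eq_sym.
Qed.

Lemma central_npendant c c' : central_pair c c' -> ~~ pendant_vertex c.
Proof.
move=> cc'; have [u /andP[cu /eqP nu]] := central_pair_arm cc'.
apply/negP => pc; apply: nu.
exact: pendant_unique pc cu (central_pair_edge cc').
Qed.

Lemma arm_leaf c c' u w : central_pair c c' -> arm c c' u ->
  edge u w -> w != c -> pendant_vertex w.
Proof.
move=> cc' /andP[cu nu] uw nw; apply/negPn/negP => /(npendant_other (u := u)).
rewrite edge_sym => /(_ uw) [x wx nx].
have [b [b' rw]] := central_pair_ray cc'.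
(* A second neighbour [x] of [w] would start a reduced walk with seven vertices. *)
suff : (size [:: x; w; u; c; c'; b; b'] <= 6)%N by [].
apply: reduced_walk_size.
rewrite -[reduced_walk _]/[&& _, _, _ & reduced_walk [:: c; c'; b; b']] rw.
by rewrite (edge_sym x) wx nx (edge_sym w) uw nw (edge_sym u) cu nu.
Qed.

Lemma arm_npendant c c' u : ~~ support_vertex c -> arm c c' u ->
  ~~ pendant_vertex u.
Proof.
move=> nc /andP[cu _]; apply: contra nc => pu.
by apply/existsP; exists u; rewrite cu.
Qed.

(** A common neighbour would close a triangle with the two centres. *)
Lemma arm_disjoint c c' u : central_pair c c' -> edge c u -> edge c' u ->
  False.
Proof.
move=> cc' cu c'u; have ecc' := central_pair_edge cc'.
have : uniq [:: c; u; c'; c].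
  apply: reduced_walk_uniq => //=.
  rewrite cu (edge_sym u) c'u (edge_sym c') ecc' !andbT /=.
  by apply/andP; split; apply/eqP => E; move: ecc' cu; rewrite E edge_irrefl.
by rewrite /= !inE eqxx !orbT.
Qed.

(** Induction along a path from [c]: the four cases together are closed under passing to a
    neighbour. *)
Lemma central_pair_cover c c' v : central_pair c c' ->
  [\/ v = c, v = c', arm c c' v || arm c' c v |
      pendant_vertex v /\ exists2 u, edge u v & arm c c' u || arm c' c u].
Proof.
move=> cc'; have c'c := central_pair_sym cc'.
have [_ /(_ c v)/connectP[p pp ->] _] := T_tree.
elim/last_ind: p pp => [|p w IHp]; first by constructor 1.
rewrite rcons_path last_rcons => /andP[/IHp].
move: (last c p) => u {IHp} Hu uw; case: Hu uw => [->|->|au|[pu [x xu ax]]] uw.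
- have [->|nw] := eqVneq w c'; first by constructor 2.
  by constructor 3; rewrite /arm uw nw.
- have [->|nw] := eqVneq w c; first by constructor 1.
  by constructor 3; rewrite /arm uw nw orbT.
- have [->|nwc] := eqVneq w c; first by constructor 1.
  have [->|nwc'] := eqVneq w c'; first by constructor 2.
  constructor 4; split; last by exists u.
  by case/orP: au => au; [apply: (arm_leaf cc' au) | apply: (arm_leaf c'c au)].
- constructor 3; suff -> : w = x by [].
  by apply: (pendant_unique pu) => //; rewrite edge_sym.
Qed.

(** * Necessity: the degree condition from a magic labeling *)

Section Magic.
Variables (Gamma : zmodType) (l : T -> Gamma).

Lemma magic_arm mu c c' u : central_pair c c' -> ~~ support_vertex c ->
  (forall v, weight l v = mu) -> arm c c' u -> l u = mu.
Proof.
move=> cc' nc lmu au; have /andP[cu _] := au.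
have uc : edge u c by rewrite edge_sym.
have [w uw nw] := npendant_other uc (arm_npendant nc au).
rewrite -(lmu w); apply/esym/weight_pendant; last by rewrite edge_sym.
exact: arm_leaf cc' au uw nw.
Qed.

Lemma magic_degree c c' : central_pair c c' -> ~~ support_vertex c ->
  vertex_magic_labeling l -> degree c <> 2.
Proof.
move=> cc' nc [l0 [mu lmu]] dc; have := lmu c; have ecc' := central_pair_edge cc'.
rewrite (weight_const (a := mu) ecc') ?dc => [|w cw nw].
  (* With a single arm at [c], the equation [l c' + mu = mu] forces the forbidden label 0 on
     [c']. *)
  by move=> /(canRL (addrK _))/eqP; rewrite subrr (negPf (l0 c')).
by apply: (magic_arm cc') => //; apply/andP.
Qed.

End Magic.

(** * Sufficiency: an explicit labeling by multiples of an element of infinite order *)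

Section Labeling.
Variables (Gamma : zmodType) (mu : Gamma) (c1 c2 : T).
Hypotheses (c12_central : central_pair c1 c2).
Hypotheses (c1_not_support : ~~ support_vertex c1).
Hypotheses (c2_not_support : ~~ support_vertex c2).
Hypothesis mu_order : forall n, (0 < n)%N -> mu *+ n != 0.
Hypotheses (c1_degree : (2 < degree c1)%N) (c2_degree : (2 < degree c2)%N).

Let c21_central := central_pair_sym c12_central.

Definition chosen_leaf u : option T :=
  [pick w | edge u w && pendant_vertex w].

Definition far_center u : T := if edge c1 u then c2 else c1.

(** The coefficient offsets [-(degree (far_center u) - 2)] from the near centre and [-1] from each
    of the [degree u - 2] other leaves, leaving exactly 1. *)
Definition leaf_label u w : Gamma :=
  if chosen_leaf u == Some w
  then mu *+ ((degree (far_center u)).-1 + (degree u - 2)) else - mu.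

(** Each centre's label balances the arms of the other centre, hence the crossed degrees. The final
    [mu] is a nonzero default for a vertex without neighbours. *)
Definition label v : Gamma :=
  if v == c1 then - (mu *+ (degree c2 - 2))
  else if v == c2 then - (mu *+ (degree c1 - 2))
  else if edge c1 v || edge c2 v then mu
  else if [pick u | edge u v] is Some u then leaf_label u v else mu.

Let c21_neq : c2 == c1 = false.
Proof.
apply/negP => /eqP E; have := central_pair_edge c12_central.
by rewrite E edge_irrefl.
Qed.

Lemma label_arm u : arm c1 c2 u || arm c2 c1 u -> label u = mu.
Proof.
rewrite /label => /orP[] /andP[cu /negPf nu]; rewrite nu cu ?orbT //.
  by case: eqP cu => // ->; rewrite edge_irrefl.
by case: eqP cu => // ->; rewrite edge_irrefl.
Qed.

Lemma label_leaf u w : edge u w -> pendant_vertex w -> label w = leaf_label u w.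
Proof.
move=> uw pw; rewrite /label.
have /negPf-> : w != c1.
  by apply: contraL pw => /eqP->; apply: central_npendant c12_central.
have /negPf-> : w != c2.
  by apply: contraL pw => /eqP->; apply: central_npendant c21_central.
have /negPf-> : ~~ edge c1 w.
  apply: contra c1_not_support => c1w.
  by apply/existsP; exists w; rewrite c1w.
have /negPf-> /= : ~~ edge c2 w.
  apply: contra c2_not_support => c2w.
  by apply/existsP; exists w; rewrite c2w.
case: pickP => [x xw|/(_ u)]; last by rewrite uw.
by rewrite (@pendant_unique _ w x u) // edge_sym.
Qed.

(** Every label is, up to sign, a positive multiple of [mu]; positivity at the centres uses that
    their degrees exceed 2. *)
Lemma label_neq0 v : label v != 0.
Proof.
have mu0 : mu != 0 by have := mu_order (ltn0Sn 0).
rewrite /label /leaf_label.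
case: ifP => _; first by rewrite oppr_eq0 mu_order // subn_gt0.
case: ifP => _; first by rewrite oppr_eq0 mu_order // subn_gt0.
case: ifP => // _; case: pickP => [u _|//]; case: ifP => _; last by rewrite oppr_eq0.
apply: mu_order; rewrite addn_gt0 /far_center.
by case: ifP => _; rewrite -subn1 subn_gt0 ltnW.
Qed.

Lemma weight_label_center c c' : central_pair c c' -> (2 < degree c)%N ->
    label c' = - (mu *+ (degree c - 2)) ->
    (forall u, arm c c' u -> label u = mu) ->
  weight label c = mu.
Proof.
move=> cc' dc lc' la.
rewrite (weight_const (a := mu) (central_pair_edge cc')) => [|w cw nw]; last first.
  by apply: la; apply/andP.
by rewrite lc'; case: (degree c) dc => [|[|n]] // _; rewrite subn2 /= mulrSr addKr.
Qed.

Lemma weight_label_arm c c' u : central_pair c c' -> (2 < degree c')%N ->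
    ~~ support_vertex c ->
    label c = - (mu *+ (degree c' - 2)) -> far_center u = c' ->
    arm c c' u ->
  weight label u = mu.
Proof.
move=> cc' dc' nc lc fu au; have /andP[cu nu] := au.
have uc : edge u c by rewrite edge_sym.
have [w uw nw] := npendant_other uc (arm_npendant nc au).
have pw := arm_leaf cc' au uw nw.
(* The leaf [w] shows that the choice succeeds; the chosen leaf [w0] may differ from it. *)
have [w0 cw0 /andP[uw0 pw0]] : exists2 w0, chosen_leaf u = Some w0 &
    edge u w0 && pendant_vertex w0.
  rewrite /chosen_leaf; case: pickP => [w0 ?|/(_ w)]; last by rewrite uw pw.
  by exists w0.
have nw0 : w0 != c.
  by apply: contraL pw0 => /eqP->; apply: central_npendant cc'.
rewrite (weight_const2 (a := - mu) uc uw0 nw0) => [|x ux nx nx0]; last first.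
  rewrite (label_leaf ux (arm_leaf cc' au ux nx)) /leaf_label cw0.
  by rewrite ifN //; apply: contra nx0 => /eqP[->].
rewrite (label_leaf uw0 pw0) /leaf_label cw0 eqxx fu lc mulNrn mulrnDr addrA addrK.
by case: (degree c') dc' => [|[|n]] // _; rewrite subn2 /= mulrSr addKr.
Qed.

Lemma label_magic : vertex_magic_labeling label.
Proof.
split; first exact: label_neq0.
have lc1 : label c1 = - (mu *+ (degree c2 - 2)) by rewrite /label eqxx.
have lc2 : label c2 = - (mu *+ (degree c1 - 2)) by rewrite /label c21_neq eqxx.
exists mu => v; have [->|->|/orP[] av|[pv [u uv au]]] := central_pair_cover v c12_central.
- by apply: (weight_label_center c12_central) => // u au; rewrite label_arm ?au.
- by apply: (weight_label_center c21_central) => // u au; rewrite label_arm ?au ?orbT.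
- apply: (weight_label_arm c12_central) => //.
  by rewrite /far_center; case/andP: av => ->.
- apply: (weight_label_arm c21_central) => //.
  (* [far_center] tests adjacency to [c1] only, so an arm at [c2] must be shown not adjacent to
     [c1]. *)
  rewrite /far_center; case: ifP => // c1v; case/andP: av => c2v _.
  by case: (arm_disjoint c12_central c1v c2v).
- by rewrite (@weight_pendant _ _ _ v u) ?label_arm // edge_sym.
Qed.

End Labeling.

Lemma central_degree c c' : central_pair c c' -> degree c <> 2 ->
  (2 < degree c)%N.
Proof.
move=> cc' d2; have := central_npendant cc'; rewrite /pendant_vertex.
by move: d2; rewrite (degreeD1 (central_pair_edge cc')); case: #|_| => [|[]].
Qed.

End Diameter5.

(** * Elements of infinite order, and the equivalence *)

Lemma not_torsion_free_element (Gamma : zmodType) : ~ torsion_group Gamma ->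
  exists mu : Gamma, forall n, (0 < n)%N -> mu *+ n != 0.
Proof.
case/existsNP => mu ntor; exists mu => n n0; apply/eqP => mun.
by apply: ntor; exists n.
Qed.

Theorem theorem4p4 (Gamma : zmodType)
    (Gamma_infinite : infinite_set [set: Gamma]%classic)
    (Gamma_not_torsion : ~ torsion_group Gamma)
    (T : sgraph) (T_tree : is_tree T) (T_diameter : diameter T = 5)
    (c1 c2 : T) (c12_central : central_pair c1 c2)
    (c1_not_support : ~~ support_vertex c1) (c2_not_support : ~~ support_vertex c2) :
  vertex_magic T Gamma <-> degree c1 <> 2 /\ degree c2 <> 2.
Proof.
have c21_central := central_pair_sym c12_central.
split=> [[l lmagic]|[d1 d2]].
  split; first exact: (magic_degree T_tree T_diameter c12_central _ lmagic).
  exact: (magic_degree T_tree T_diameter c21_central _ lmagic).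
have [mu mu_order] := not_torsion_free_element Gamma_not_torsion.
exists (label mu c1 c2); apply: label_magic => //.
- exact: central_degree c12_central d1.
- exact: central_degree c21_central d2.
Qed.
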